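(* Let $\tilde P$ be the pseudo-marginal kernel with proposal $q$, acceptance ratio $r$ and weight distributions $\{Q_x\}_{x\in\mathsf X}$, and assume there exists a nondecreasing convex function $\phi:[0,\infty)\to[1,\infty)$ with $\liminf_{t\to\infty}\phi(t)/t=\infty$ and $\sup_{x\in\mathsf X}\int\phi(w)Q_x(\mathrm dw)<\infty$. Denote by $P_{\mathrm{acc}}$ the sub-probability kernel $P_{\mathrm{acc}}(x,A):=\int_Aq(x,\mathrm dy)\min\{1,r(x,y)\}$. Suppose there exist $\varepsilon>0$, an integer $n\in[1,\infty)$ and a probability measure $\nu$ on $(\mathsf X,\mathcal B(\mathsf X))$ such that for any $A\in\mathcal B(\mathsf X)$, $$P_{\mathrm{acc}}^n(x,A)\ge\varepsilon\nu(A)\qquad\text{for all }x\in\mathsf X.$$ Then there exist $\bar w_0\in(1,\infty)$, $\tilde\varepsilon>0$ and a probability measure $\tilde\nu$ on $(\mathsf X\times\mathsf W,\mathcal B(\mathsf X)\times\mathcal B(\mathsf W))$ such that for all $\bar w\in[\bar w_0,\infty)$, $$\tilde P^n(x,w;\cdot)\ge\frac{\tilde\varepsilon}{\bar w}\tilde\nu(\cdot)\qquad\text{for all }(x,w)\in\mathsf X\times\mathsf W\text{ with }w\in(0,\bar w].$$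
   Context: Let $(\mathsf X,\mathcal B(\mathsf X))$ be a measurable space, $\pi$ a probability measure on it and $q(x,\mathrm dy)$ a Markov kernel on $\mathsf X$. The function $r(x,y)=\frac{\pi(\mathrm dy)q(y,\mathrm dx)}{\pi(\mathrm dx)q(x,\mathrm dy)}$ is the Radon--Nikodym derivative in the sense of Tierney: there is a symmetric measurable set $R\subset\mathsf X^2$ on which the measures $\pi(\mathrm dx)q(x,\mathrm dy)$ and $\pi(\mathrm dy)q(y,\mathrm dx)$ are mutually absolutely continuous, and on whose complement they are mutually singular; on $R$, $r$ is the density of the second with respect to the first, with values in $(0,\infty)$ and $r(x,y)r(y,x)=1$; off $R$, $r:=0$. Let $\mathsf W$ be a Borel subset of $\mathbb R_+=[0,\infty)$ and let $x\mapsto Q_x$ be a probability kernel from $\mathsf X$ to $\mathsf W$ with $\int w\,Q_x(\mathrm dw)=1$ for all $x$. The pseudo-marginal kernel is $\tilde P(x,w;\mathrm dy,\mathrm du)=\min\{1,r(x,y)\frac uw\}q(x,\mathrm dy)Q_y(\mathrm du)+\delta_{x,w}(\mathrm dy,\mathrm du)\tilde\rho(x,w)$ with $\tilde\rho(x,w)=1-\iint\min\{1,r(x,y)\frac uw\}q(x,\mathrm dy)Q_y(\mathrm du)$. Powers of kernels denote iterated composition. *)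

(* Defs.v *)
From HB Require Import structures.
From mathcomp Require Import all_boot all_order all_algebra.
From mathcomp Require Import all_classical all_reals all_analysis.
From mathcomp Require Import unstable measurable_realfun.

Set Implicit Arguments.
Unset Strict Implicit.
Unset Printing Implicit Defensive.
Import Order.TTheory GRing.Theory Num.Theory.
Import numFieldNormedType.Exports.

Local Open Scope classical_set_scope.
Local Open Scope ring_scope.
Local Open Scope ereal_scope.

Definition nonempty_subset (R : realType) (W : set R) (Wn : W !=set0) : Type :=
  set_type W.

Section nonempty_subset.
Context (R : realType) (W : set R) (Wn : W !=set0).

HB.instance Definition _ := SubChoice.on (nonempty_subset Wn).
HB.instance Definition _ := isPointed.Build (nonempty_subset Wn)
  (exist _ (projT1 (cid Wn)) (mem_set (projT2 (cid Wn)))).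

End nonempty_subset.

(* W with the trace of the Borel sigma-algebra.  Measurable types are pointed, *)
(* whence the nonemptiness argument.                                           *)
Definition subset_space (R : realType) (W : set R) (Wn : W !=set0) :=
  g_sigma_algebra_preimageType
    (fun w : nonempty_subset Wn => \val w : R).

HB.instance Definition _ (R : realType) (W : set R) (Wn : W !=set0) :=
  Measurable.on (subset_space Wn).

Definition wval (R : realType) (W : set R) (Wn : W !=set0)
  (w : subset_space Wn) : R := \val (w : nonempty_subset Wn).

Lemma measurable_wval (R : realType) (W : set R) (Wn : W !=set0) :
  measurable_fun [set: subset_space Wn] (@wval R W Wn).
Proof. by move=> _ B mB; rewrite setTI; exists B => //; rewrite setTI. Qed.

(* The measure m(dx) k(x,dy) on T1 * T2. *)
Section joint.
Context d1 d2 (T1 : measurableType d1) (T2 : measurableType d2) (R : realType).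
Variables (m : {measure set T1 -> \bar R}) (k : R.-fker T1 ~> T2).

Definition joint (A : set (T1 * T2)) : \bar R := \int[m]_x k x (xsection A x).

Let joint0 : joint set0 = 0.
Proof. by apply: integral0_eq => x _; rewrite xsection0 measure0. Qed.

Let joint_ge0 A : 0 <= joint A.
Proof. exact: integral_ge0. Qed.

Let joint_additive : semi_sigma_additive joint.
Proof.
move=> F mF tF mUF.
rewrite [X in _ --> X](_ : _ = \sum_(n <oo) joint (F n)).
  by apply: is_cvg_nneseries => n _ _; exact: joint_ge0.
rewrite -integral_nneseries//; last first.
  by move=> n; apply: measurable_fun_xsection_finite_kernel; rewrite inE.
apply: eq_integral => x _; rewrite xsection_bigcup.
rewrite measure_semi_bigcup//.
- by move=> n; exact: measurable_xsection.
- exact: trivIset_xsection.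
- by apply: bigcup_measurable => n _; exact: measurable_xsection.
Qed.

HB.instance Definition _ :=
  isMeasure.Build _ _ R joint joint0 joint_ge0 joint_additive.

End joint.

(* An acceptance probability a(s,t); a proposal t drawn from k(s,dt) is kept   *)
(* with probability a(s,t), and otherwise the chain stays at s.                *)
Record acceptance d d' (S : measurableType d) (T : measurableType d')
    (R : realType) := Acceptance {
  acceptance_fun :> S * T -> R ;
  acceptance_measurable : measurable_fun [set: S * T] acceptance_fun ;
  acceptance_itv : forall st, (0 <= acceptance_fun st <= 1)%R }.

Section accepted.
Context d d' (S : measurableType d) (T : measurableType d') (R : realType).
Variables (k : R.-pker S ~> T) (a : acceptance S T R).

Definition accepted (s : S) (A : set T) : \bar R :=
  \int[k s]_(t in A) (a (s, t))%:E.

Let a_ge0 st : 0 <= (a st)%:E.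
Proof. by rewrite lee_fin; case/andP: (acceptance_itv a st). Qed.

Let a_section s : measurable_fun [set: T] (fun t => (a (s, t))%:E).
Proof.
apply/measurable_EFinP; apply: (measurableT_comp (acceptance_measurable a)).
exact: measurable_pair1.
Qed.

Let accepted0 s : accepted s set0 = 0.
Proof. exact: integral_set0. Qed.

Let accepted_ge0 s A : 0 <= accepted s A.
Proof. exact: integral_ge0. Qed.

Let accepted_additive s : semi_sigma_additive (accepted s).
Proof.
move=> F mF tF mUF.
rewrite /accepted ge0_integral_bigcup//.
  by apply: is_cvg_nneseries => n _ _; exact: accepted_ge0.
exact: measurable_funTS.
Qed.

HB.instance Definition _ s := isMeasure.Build _ _ R
  (accepted s) (accepted0 s) (accepted_ge0 s) (@accepted_additive s).

Definition accepted_kernel : S -> {measure set T -> \bar R} := accepted.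

Let measurable_accepted U : measurable U ->
  measurable_fun [set: S] (accepted_kernel ^~ U).
Proof.
move=> mU.
pose f (st : S * T) := (a st * \1_U st.2)%:E.
have -> : accepted_kernel ^~ U = kfcomp k f.
  apply/funext => s; rewrite /accepted_kernel/= /accepted integral_mkcond.
  apply: eq_integral => t _; rewrite /f patchE indicE/=.
  by case: ifPn => _; rewrite ?mulr1 ?mulr0.
apply: measurable_kfcomp => [|st].
  apply/measurable_EFinP; apply: measurable_funM.
    exact: acceptance_measurable.
  by apply: measurableT_comp; [exact: measurable_indic|exact: measurable_snd].
by rewrite /f EFinM mule_ge0// lee_fin.
Qed.

HB.instance Definition _ :=
  isKernel.Build _ _ _ _ R accepted_kernel measurable_accepted.

Lemma accepted_le1 s : accepted s [set: T] <= 1.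
Proof.
rewrite -(@prob_kernel _ _ _ _ _ k s) -[leRHS]mul1e -integral_cst//.
apply: ge0_le_integral => // t _; rewrite lee_fin.
by case/andP: (acceptance_itv a (s, t)).
Qed.

Let accepted_sprob :
  ereal_sup [set accepted_kernel s [set: T] | s in [set: S]] <= 1.
Proof. by apply: ge_ereal_sup => _ [s _ <-]; exact: accepted_le1. Qed.

HB.instance Definition _ := Kernel_isSubProbability.Build
  _ _ _ _ R accepted_kernel accepted_sprob.

End accepted.

Section accept_reject.
Context d (S : measurableType d) (R : realType).
Variables (k : R.-pker S ~> S) (a : acceptance S S R).

Definition accept_reject (s : S) (A : set S) : \bar R :=
  accepted k a s A + \d_s A * (1 - accepted k a s [set: S]).

Let accepted_fin s : accepted k a s [set: S] \is a fin_num.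
Proof.
by rewrite ge0_fin_numE//; exact: le_lt_trans (accepted_le1 k a s) (ltry _).
Qed.

Let rho_ge0 s : 0 <= 1 - accepted k a s [set: S].
Proof. by rewrite sube_ge0 ?accepted_le1// accepted_fin. Qed.

Let rho s : {nonneg R} := NngNum (fine_ge0 (rho_ge0 s)).

Let rhoE s : (rho s)%:num%:E = 1 - accepted k a s [set: S].
Proof. by rewrite /= fineK// fin_numB accepted_fin. Qed.

Let accept_rejectE s :
  accept_reject s = measure_add (accepted k a s) (mscale (rho s) (\d_s)).
Proof.
apply/funext => A; rewrite measure_addE /accept_reject/= /mscale rhoE.
by rewrite muleC.
Qed.

Let accept_reject0 s : accept_reject s set0 = 0.
Proof. by rewrite /accept_reject !measure0 mul0e adde0. Qed.

Let accept_reject_ge0 s A : 0 <= accept_reject s A.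
Proof. by rewrite /accept_reject adde_ge0// mule_ge0. Qed.

Let accept_reject_additive s : semi_sigma_additive (accept_reject s).
Proof. by rewrite accept_rejectE; exact: measure_semi_sigma_additive. Qed.

HB.instance Definition _ s := isMeasure.Build _ _ R (accept_reject s)
  (accept_reject0 s) (accept_reject_ge0 s) (@accept_reject_additive s).

Definition accept_reject_kernel : S -> {measure set S -> \bar R} :=
  accept_reject.

Let measurable_accept_reject U : measurable U ->
  measurable_fun [set: S] (accept_reject_kernel ^~ U).
Proof.
move=> mU; apply: emeasurable_funD.
  exact: (measurable_kernel (accepted_kernel k a)).
apply: emeasurable_funM.
  by apply/measurable_EFinP; exact: measurable_indic.
apply: emeasurable_funB => //.
exact: (measurable_kernel (accepted_kernel k a)).
Qed.

HB.instance Definition _ :=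
  isKernel.Build _ _ _ _ R accept_reject_kernel measurable_accept_reject.

Let accept_reject_prob s : accept_reject_kernel s [set: S] = 1.
Proof.
rewrite /accept_reject_kernel/= /accept_reject diracT mul1e addeC.
by rewrite subeK ?accepted_fin.
Qed.

HB.instance Definition _ := Kernel_isProbability.Build
  _ _ _ _ R accept_reject_kernel accept_reject_prob.

End accept_reject.

Fixpoint kernel_pow d (S : measurableType d) (R : realType)
    (k : R.-spker S ~> S) (n : nat) : R.-spker S ~> S :=
  if n is n'.+1 then mkcomp_noparam k (kernel_pow k n')
  else kdirac (@measurable_id _ S setT).

Section proposal.
Context d d' (X : measurableType d) (W : measurableType d') (R : realType).
Variables (q : R.-pker X ~> X) (Q : R.-pker X ~> W).

(* q(x,dy) Q_y(du), as a kernel from (x,w). *)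
Definition weighted_proposal (xw : X * W) : {measure set (X * W) -> \bar R} :=
  joint (q xw.1) Q.

Let measurable_weighted_proposal U : measurable U ->
  measurable_fun [set: X * W] (weighted_proposal ^~ U).
Proof.
move=> mU; rewrite /weighted_proposal/= /joint.
apply: (@measurableT_comp _ _ _ _ _ _
  (fun x => \int[q x]_y Q y (xsection U y)) _ fst) => //.
apply: (@measurable_kfcomp _ _ _ _ _ q
  (fun xy : X * X => Q xy.2 (xsection U xy.2))) => //.
apply: (@measurableT_comp _ _ _ _ _ _
  (fun y => Q y (xsection U y)) _ snd) => //.
by apply: measurable_fun_xsection_finite_kernel; rewrite inE.
Qed.

HB.instance Definition _ :=
  isKernel.Build _ _ _ _ R weighted_proposal measurable_weighted_proposal.

Let weighted_proposal_prob xw : weighted_proposal xw [set: X * W] = 1.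
Proof.
rewrite /weighted_proposal/= /joint.
under eq_integral do rewrite xsectionE preimage_setT prob_kernel.
by rewrite integral_cst// mul1e prob_kernel.
Qed.

HB.instance Definition _ := Kernel_isProbability.Build
  _ _ _ _ R weighted_proposal weighted_proposal_prob.

End proposal.

Definition mutually_singular d (T : measurableType d) (R : realType)
    (m1 m2 : set T -> \bar R) :=
  exists A, [/\ measurable A, m1 A = 0 & m2 (~` A) = 0].

(* r(x,y) = pi(dy) q(y,dx) / (pi(dx) q(x,dy)) in the sense of Tierney: with    *)
(* mu(dx,dy) = pi(dx) q(x,dy), pushforward mu swap is pi(dy) q(y,dx).          *)
Record tierney_ratio d (X : measurableType d) (R : realType)
    (pi : probability X R) (q : R.-pker X ~> X) := TierneyRatio {
  ratio :> X * X -> R ;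
  ratio_set : set (X * X) ;
  measurable_ratio : measurable_fun [set: X * X] ratio ;
  measurable_ratio_set : measurable ratio_set ;
  ratio_set_sym : forall x y, ratio_set (x, y) -> ratio_set (y, x) ;
  ratio_set_dominated :
    mrestr (joint pi q) measurable_ratio_set `<<
    mrestr (pushforward (joint pi q) swap) measurable_ratio_set ;
  ratio_set_dominates :
    mrestr (pushforward (joint pi q) swap) measurable_ratio_set `<<
    mrestr (joint pi q) measurable_ratio_set ;
  ratio_set_singular :
    mutually_singular
      (mrestr (joint pi q) (measurableC measurable_ratio_set))
      (mrestr (pushforward (joint pi q) swap)
        (measurableC measurable_ratio_set)) ;
  ratio_density : forall A, measurable A -> A `<=` ratio_set ->
    pushforward (joint pi q) swap A = \int[joint pi q]_(z in A) (ratio z)%:E ;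
  ratio_gt0 : forall z, ratio_set z -> (0 < ratio z)%R ;
  ratio_inv : forall x y, ratio_set (x, y) ->
    (ratio (x, y) * ratio (y, x) = 1)%R ;
  ratio_out : forall z, ~ ratio_set z -> ratio z = 0%R }.

Lemma measurable_invr (R : realType) : measurable_fun [set: R] (@GRing.inv R).
Proof.
have o0 : open (~` [set (0 : R)%R]) by exact/closed_openC/closed_eq.
rewrite -(setvU [set (0 : R)%R]); apply/measurable_funU => //.
  exact: open_measurable.
split; last exact: measurable_fun_set1.
apply: open_continuous_measurable_fun => // x; rewrite inE => /eqP x0.
exact: inv_continuous.
Qed.

Section pseudo_marginal.
Context d (X : measurableType d) (R : realType).
Context (pi : probability X R) (q : R.-pker X ~> X) (r : tierney_ratio pi q).

Lemma ratio_ge0 z : (0 <= r z)%R.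
Proof.
have [rz|rz] := pselect (ratio_set r z); first exact/ltW/ratio_gt0.
by rewrite ratio_out.
Qed.

Let marginal_measurable :
  measurable_fun [set: X * X] (fun xy => Num.min 1 (r xy))%R.
Proof. by apply: measurable_minr => //; exact: measurable_ratio. Qed.

Let marginal_itv xy : (0 <= Num.min 1 (r xy) <= 1)%R.
Proof. by rewrite le_min ler01 ratio_ge0 ge_min lexx. Qed.

Definition marginal_acceptance : acceptance X X R :=
  Acceptance marginal_measurable marginal_itv.

Definition P_acc : R.-spker X ~> X := accepted_kernel q marginal_acceptance.

Lemma P_accE x A :
  P_acc x A = \int[q x]_(y in A) (Num.min 1 (r (x, y)))%R%:E.
Proof. by []. Qed.

Context (W : set R) (Wn : W !=set0) (W_ge0 : W `<=` `[0%R, +oo[).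
Local Notation XW := (X * subset_space Wn)%type.

(* The value for w = 0 (division by zero yields 0, so the proposal is         *)
(* rejected) has no effect on iterates started at w > 0: a move from w > 0    *)
(* to u = 0 is accepted with probability 0.                                   *)
Definition pseudo_marginal_prob (z : XW * XW) : R :=
  let: ((x, w), (y, u)) := z in
  (Num.min 1 (r (x, y) * (wval u / wval w)))%R.

Let alpha_measurable : measurable_fun [set: XW * XW] pseudo_marginal_prob.
Proof.
have -> : pseudo_marginal_prob = fun z =>
    Num.min 1%R (r (z.1.1, z.2.1) * (wval z.2.2 / wval z.1.2))%R.
  by apply/funext => -[[? ?] [? ?]].
apply: measurable_minr => //; apply: measurable_funM.
  apply: measurableT_comp; first exact: measurable_ratio.
  by apply: measurable_fun_pair => /=; apply: measurableT_comp.
apply: measurable_funM.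
  apply: measurableT_comp; first exact: measurable_wval.
  exact: measurableT_comp.
apply: (@measurableT_comp _ _ _ _ _ _ (@GRing.inv R) setT
  (fun z : XW * XW => wval z.1.2) (@measurable_invr R)).
apply: measurableT_comp; first exact: measurable_wval.
exact: measurableT_comp.
Qed.

Lemma wval_ge0 (w : subset_space Wn) : (0 <= wval w)%R.
Proof.
have /set_mem /W_ge0 := valP (w : nonempty_subset Wn).
by rewrite /= in_itv/= andbT.
Qed.

Let alpha_itv z : (0 <= pseudo_marginal_prob z <= 1)%R.
Proof.
case: z => -[x w] [y u]; rewrite /pseudo_marginal_prob le_min ler01 ge_min lexx /= andbT.
by rewrite mulr_ge0 ?ratio_ge0// divr_ge0// wval_ge0.
Qed.

Definition pseudo_marginal_acceptance : acceptance XW XW R :=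
  Acceptance alpha_measurable alpha_itv.

Definition pseudo_marginal (Q : R.-pker X ~> subset_space Wn) :
    R.-pker XW ~> XW :=
  accept_reject_kernel (weighted_proposal q Q) pseudo_marginal_acceptance.

Lemma pseudo_marginalE (Q : R.-pker X ~> subset_space Wn) x w A :
  pseudo_marginal Q (x, w) A =
  \int[joint (q x) Q]_(yu in A) (pseudo_marginal_prob ((x, w), yu))%:E +
  \d_(x, w) A *
    (1 - \int[joint (q x) Q]_yu (pseudo_marginal_prob ((x, w), yu))%:E).
Proof. by []. Qed.

End pseudo_marginal.

(* Main.v *)
Require Import Defs.
From HB Require Import structures.
From mathcomp Require Import all_boot all_order all_algebra.
From mathcomp Require Import all_classical all_reals all_analysis.
From mathcomp Require Import measurable_realfun.

(** The proof splits an accepted pseudo-marginal move into an accepted move of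
    the marginal chain and an independent thinning of the new weight. Since
    min(1, a b) >= min(1, a) min(1, b) for a, b >= 0, a move from (x, w) to
    (y, u) with 0 < w <= b and 1 <= b is accepted with probability at least

      b^-1 * min(1, r(x, y)) * h(u),    h(u) = min(1, u) 1_(u <= M),

    whatever M is ([acceptance_factor]). The factor h forgets the current weight
    at the cost of b^-1, and it forces the new weight into (0, M], so that the
    next move satisfies the same bound with M in place of b. Iterating
    ([kernel_pow_pseudo_marginal_ge]), the n-step kernel started at (x, w)
    dominates

      b^-1 * (c / M)^(n-1) * P_acc^n(x, dy) h(u) Q_y(du),

    where c is a lower bound, uniform in y, of the integral of h against Q_y:
    each of the n - 1 intermediate weights is integrated out and costs a factor
    c / M. The minorization of P_acc^n then replaces P_acc^n(x, dy) by
    eps nu(dy), and nu' is the normalization of nu(dy) h(u) Q_y(du).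

    The moment condition enters only through c. As the Q_y have mean 1 and the
    superlinear phi has bounded integrals, a level M can be chosen beyond which
    the weights contribute at most 1/2 to every mean; the other half comes from
    weights u <= M, for which u <= M h(u), so c = 1 / (2 M) is suitable
    ([truncated_mean_ge]).

    All kernels involved are mixtures of other kernels, and the integrals
    against them are computed by the single lemma [integral_mixture]. *)

Set Implicit Arguments.
Unset Strict Implicit.
Unset Printing Implicit Defensive.
Import Order.TTheory GRing.Theory Num.Theory.
Import numFieldNormedType.Exports.

Local Open Scope classical_set_scope.
Local Open Scope ring_scope.
Local Open Scope ereal_scope.

(** * Integration against mixtures of measures *)

Import HBNNSimple.

Lemma integral_mixture_nnsfun (R : realType) d d' (T : measurableType d)
    (Z : measurableType d') (m : {measure set T -> \bar R})
    (k : T -> {measure set Z -> \bar R}) (mu : {measure set Z -> \bar R})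
    (mk : forall U, measurable U -> measurable_fun [set: T] (k ^~ U))
    (muE : forall U, measurable U -> mu U = \int[m]_x k x U)
    (f : {nnsfun Z >-> R}) :
  \int[mu]_z (f z)%:E = \int[m]_x \int[k x]_z (f z)%:E.
Proof.
rewrite integralT_nnsfun sintegralE.
under [RHS]eq_integral do rewrite integralT_nnsfun sintegralE.
rewrite ge0_integral_fsum//; last 2 first.
- by move=> r; apply: measurable_funeM; exact: mk.
- move=> r x _; apply: (@mulemu_ge0 _ _ _ _ _ (fun r => f @^-1` [set r])).
  exact: preimage_nnfun0.
apply: eq_fsbigr => r _.
have [r0|r0] := leP 0%R r.
  by rewrite ge0_integralZl ?muE//; exact: mk.
rewrite preimage_nnfun0// measure0 mule0 integral0_eq// => x _.
by rewrite measure0 mule0.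
Qed.

(** A measure given on sets as a mixture of the [k x] is also one on nonnegative
    functions. Taking for [k x] a pushforward, a scaled Dirac mass or a kernel
    yields the integration rules for [joint], for densities and for compositions
    of kernels. *)
Lemma integral_mixture (R : realType) d d' (T : measurableType d)
    (Z : measurableType d') (m : {measure set T -> \bar R})
    (k : T -> {measure set Z -> \bar R}) (mu : {measure set Z -> \bar R})
    (mk : forall U, measurable U -> measurable_fun [set: T] (k ^~ U))
    (muE : forall U, measurable U -> mu U = \int[m]_x k x U)
    (f : Z -> \bar R) (f0 : forall z, 0 <= f z)
    (mf : measurable_fun [set: Z] f) :
  \int[mu]_z f z = \int[m]_x \int[k x]_z f z.
Proof.
pose g := nnsfun_approx measurableT mf.
have mg n : measurable_fun [set: Z] (EFin \o g n) by exact/measurable_EFinP.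
have g0 n z : setT z -> 0 <= (EFin \o g n) z by rewrite lee_fin.
have ndg z : setT z -> nondecreasing_seq (fun n => (EFin \o g n) z).
  by move=> _ a b ab; rewrite lee_fin; exact/lefP/nd_nnsfun_approx.
have limg (l : {measure set Z -> \bar R}) :
    \int[l]_z f z = limn (fun n => \int[l]_z (g n z)%:E).
  rewrite -monotone_convergence//.
  apply: eq_integral => z _; apply/esym/cvg_lim => //.
  exact: cvg_nnsfun_approx.
rewrite limg.
under eq_fun do rewrite (integral_mixture_nnsfun mk muE).
under [RHS]eq_integral do rewrite limg.
rewrite monotone_convergence//.
- move=> n; apply: measurable_fun_integral_kernel => //; last exact: mg.
  by move=> z; exact: g0.
- by move=> n x _; apply: integral_ge0 => z _; exact: g0.
- move=> x xT a b ab; apply: ge0_le_integral => //.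
  + by move=> z _; exact: g0.
  + exact: mg.
  + exact: mg.
  + by move=> z _; exact: (ndg z).
Qed.

Lemma ge0_integral_joint (R : realType) d1 d2 (T1 : measurableType d1)
    (T2 : measurableType d2) (m : {measure set T1 -> \bar R})
    (k : R.-fker T1 ~> T2) (f : T1 * T2 -> \bar R) (f0 : forall z, 0 <= f z)
    (mf : measurable_fun [set: T1 * T2] f) :
  \int[joint m k]_z f z = \int[m]_x \int[k x]_y f (x, y).
Proof.
have mpair x : measurable_fun [set: T2] (pair x : T2 -> T1 * T2).
  exact: measurable_pair1.
(* joint m k mixes the images of the k x under y |-> (x, y) *)
pose K x : {measure set (T1 * T2) -> \bar R} :=
  measure_function_pushforward__canonical__measure_function_Measure
    (k x) (mpair x).
rewrite (@integral_mixture _ _ _ _ _ m K (joint m k))//.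
- apply: eq_integral => x _.
  by rewrite ge0_integral_pushforward//= preimage_setT.
- move=> U mU; rewrite /K/= /pushforward.
  under eq_fun do rewrite -xsectionE.
  by apply: measurable_fun_xsection_finite_kernel; rewrite inE.
- by move=> U mU; apply: eq_integral => x _; rewrite xsectionE.
Qed.

Lemma ge0_integral_accepted (R : realType) d d' (S : measurableType d)
    (T : measurableType d') (k : R.-pker S ~> T) (a : acceptance S T R) s
    (f : T -> \bar R) (f0 : forall t, 0 <= f t)
    (mf : measurable_fun [set: T] f) :
  \int[accepted k a s]_t f t = \int[k s]_t ((a (s, t))%:E * f t).
Proof.
have a0 t : (0 <= a (s, t))%R by case/andP: (acceptance_itv a (s, t)).
have ma : measurable_fun [set: T] (fun t => (a (s, t))%:E).
  apply/measurable_EFinP; apply: (measurableT_comp (acceptance_measurable a)).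
  exact: measurable_pair1.
(* a measure with density a mixes the point masses a(t) d_t *)
pose K t : {measure set T -> \bar R} := mscale (NngNum (a0 t)) (\d_t).
rewrite (@integral_mixture _ _ _ _ _ (k s) K (accepted k a s))//.
- apply: eq_integral => t _.
  by rewrite ge0_integral_mscale//= integral_dirac// diracT mul1e.
- move=> U mU; rewrite /K/= /mscale/=; apply: emeasurable_funM => //.
  by apply/measurable_EFinP; exact: measurable_indic.
- move=> U mU; rewrite [LHS]integral_mkcond; apply: eq_integral => t _.
  rewrite patchE /K/= /mscale/= diracE.
  by case: ifPn => _; rewrite ?mule1 ?mule0.
Qed.

Lemma joint_setT_itv (R : realType) d1 d2 (T1 : measurableType d1)
    (T2 : measurableType d2) (m : probability T1 R) (k : R.-spker T1 ~> T2)
    (c : R) :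
  (0 <= c)%R -> (forall x, c%:E <= k x [set: T2]) ->
  c%:E <= joint m k [set: T1 * T2] <= 1.
Proof.
move=> c0 ck.
have -> : joint m k setT = \int[m]_x k x setT.
  by apply: eq_integral => x _; rewrite xsectionE preimage_setT.
have mk : measurable_fun [set: T1] (fun x => k x setT).
  exact: measurable_kernel.
have intc (a : R) : \int[m]_x a%:E = a%:E.
  by rewrite integral_cst//= [X in _ * X]probability_setT mule1.
apply/andP; split.
  by rewrite -[leLHS]intc; apply: ge0_le_integral => // x _; rewrite lee_fin.
rewrite -[leRHS]intc; apply: ge0_le_integral => // x _.
exact: sprob_kernel_le1.
Qed.

(** [mnormalize] returns [P] itself for a null or infinite measure, hence the
    hypothesis on the total mass. *)
Lemma mnormalizeE (R : realType) d (T : measurableType d)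
    (mu : {measure set T -> \bar R}) (P : probability T R) (A : set T) :
  0 < mu [set: T] < +oo ->
  mu A = (fine (mu [set: T]))%:E * mnormalize mu P A.
Proof.
move=> /andP[mu0 muoo].
have mu_gt0 : (0 < fine (mu setT))%R by rewrite fine_gt0// mu0 muoo.
rewrite /mnormalize ifF; last first.
  by rewrite (gt_eqF mu0) (lt_eqF muoo).
by rewrite muleCA -EFinM divff ?mule1// gt_eqF.
Qed.

Lemma integral_kernel_pow1 (R : realType) d (S : measurableType d)
    (k : R.-spker S ~> S) s (f : S -> \bar R) (f0 : forall t, 0 <= f t)
    (mf : measurable_fun [set: S] f) :
  \int[kernel_pow k 1 s]_t f t = \int[k s]_t f t.
Proof.
rewrite (@integral_mixture _ _ _ _ _ (k s) (kernel_pow k 0))//; last first.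
  exact: measurable_kernel.
by apply: eq_integral => t _; rewrite integral_dirac// diracT mul1e.
Qed.

Lemma integral_kernel_powS (R : realType) d (S : measurableType d)
    (k : R.-spker S ~> S) n s (f : S -> \bar R) (f0 : forall t, 0 <= f t)
    (mf : measurable_fun [set: S] f) :
  \int[kernel_pow k n.+1 s]_t f t =
  \int[k s]_t \int[kernel_pow k n t]_u f u.
Proof. by apply: integral_mixture => //; exact: measurable_kernel. Qed.

(** * One step of the pseudo-marginal chain *)

(** The function h of the introductory comment, the probability with which a
    proposed weight is kept. *)
Definition truncated_weight (R : realType) (W : set R) (Wn : W !=set0) (M : R)
    (u : subset_space Wn) : R :=
  (Num.min 1 (wval u) * \1_(@wval R W Wn @^-1` `]-oo, M]) u)%R.

Lemma measurable_truncated_weight (R : realType) (W : set R) (Wn : W !=set0)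
    (M : R) :
  measurable_fun [set: subset_space Wn] (@truncated_weight R W Wn M).
Proof.
apply: measurable_funM.
  by apply: measurable_minr => //; exact: measurable_wval.
apply: measurable_indic; rewrite -[X in measurable X]setTI.
exact: measurable_wval.
Qed.

Lemma truncated_weight_itv (R : realType) (W : set R) (Wn : W !=set0)
    (W_ge0 : W `<=` `[0%R, +oo[) (M : R) (u : subset_space Wn) :
  (0 <= truncated_weight M u <= 1)%R.
Proof.
rewrite /truncated_weight indicE mulr_ge0 ?le_min ?ler01 ?(wval_ge0 W_ge0)//=.
by case: (_ \in _); rewrite ?mulr1 ?mulr0// ge_min lexx.
Qed.

Lemma truncated_weight_le (R : realType) (W : set R) (Wn : W !=set0)
    (W_ge0 : W `<=` `[0%R, +oo[) (M : R) (u : subset_space Wn) :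
  (truncated_weight M u <= Num.min 1 (wval u))%R.
Proof.
rewrite /truncated_weight indicE ler_piMr ?le_min ?ler01 ?(wval_ge0 W_ge0)//.
by case: (_ \in _).
Qed.

Definition truncated_acceptance d (X : measurableType d) (R : realType)
    (W : set R) (Wn : W !=set0) (W_ge0 : W `<=` `[0%R, +oo[) (M : R) :
    acceptance X (subset_space Wn) R :=
  @Acceptance _ _ _ _ _ (fun xu => truncated_weight M xu.2)
    (measurableT_comp (measurable_truncated_weight M) (@measurable_snd _ _ _ _))
    (fun xu => truncated_weight_itv W_ge0 M xu.2).

(** Accepting u with probability h(u) gives Q_x the density h. *)
Definition truncated_kernel d (X : measurableType d) (R : realType)
    (W : set R) (Wn : W !=set0) (W_ge0 : W `<=` `[0%R, +oo[) (M : R)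
    (Q : R.-pker X ~> subset_space Wn) : R.-spker X ~> subset_space Wn :=
  accepted_kernel Q (truncated_acceptance X Wn W_ge0 M).

(** As w <= b and 1 <= b, both 1 and u / w are at least h(u) / b. *)
Lemma acceptance_factor (R : realType) d (X : measurableType d)
    (pi : probability X R) (q : R.-pker X ~> X) (r : tierney_ratio pi q)
    (W : set R) (Wn : W !=set0) (W_ge0 : W `<=` `[0%R, +oo[) (M b : R)
    (x y : X) (w u : subset_space Wn) :
  (1 <= b)%R -> (0 < wval w)%R -> (wval w <= b)%R ->
  (b^-1 * (Num.min 1 (r (x, y)) * truncated_weight M u) <=
   pseudo_marginal_acceptance r Wn W_ge0 ((x, w), (y, u)))%R.
Proof.
move=> b1 w0 wb; have b0 : (0 < b)%R := lt_le_trans w0 wb.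
have r0 := ratio_ge0 r (x, y); have u0 := wval_ge0 W_ge0 u.
have [h0 h1] := andP (truncated_weight_itv W_ge0 M u).
have hu := truncated_weight_le W_ge0 M u.
rewrite /= le_min; apply/andP; split.
  rewrite ler_pdivrMl// mulr1; apply: le_trans b1.
  by rewrite mulr_ile1// ?le_min ?ler01 ?ge_min ?lexx.
rewrite mulrCA ler_pM// ?le_min ?ler01// ?ge_min ?lexx ?orbT//.
  by rewrite mulr_ge0// invr_ge0 ltW.
rewrite mulrC ler_pM ?invr_ge0 ?(ltW b0)//; last by rewrite lef_pV2.
by rewrite (le_trans hu)// ge_min lexx orbT.
Qed.

(** The rejected mass is dropped, and [acceptance_factor] is integrated over the
    accepted moves. *)
Lemma pseudo_marginal_ge (R : realType) d (X : measurableType d)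
    (pi : probability X R) (q : R.-pker X ~> X) (r : tierney_ratio pi q)
    (W : set R) (Wn : W !=set0) (W_ge0 : W `<=` `[0%R, +oo[)
    (Q : R.-pker X ~> subset_space Wn) (M b : R) (x : X)
    (w : subset_space Wn) (U : set (X * subset_space Wn)) :
  (1 <= b)%R -> (0 < wval w)%R -> (wval w <= b)%R -> measurable U ->
  b^-1%:E * joint (P_acc r x) (truncated_kernel W_ge0 M Q) U <=
  pseudo_marginal r W_ge0 Q (x, w) U.
Proof.
move=> b1 w0 wb mU; have b0 : (0 < b)%R := lt_le_trans w0 wb.
have bV0 : 0 <= b^-1%:E by rewrite lee_fin invr_ge0 ltW.
have h0 u := proj1 (andP (truncated_weight_itv W_ge0 M u)).
pose alpha z := pseudo_marginal_acceptance r Wn W_ge0 ((x, w), z).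
have alpha0 z : (0 <= alpha z)%R by case/andP: (acceptance_itv
  (pseudo_marginal_acceptance r Wn W_ge0) ((x, w), z)).
have malpha : measurable_fun setT (fun z => (alpha z)%:E).
  apply/measurable_EFinP.
  apply: (measurableT_comp (acceptance_measurable
    (pseudo_marginal_acceptance r Wn W_ge0))).
  exact: measurable_pair1.
have malphaU : measurable_fun setT ((fun z => (alpha z)%:E) \_ U).
  apply/(measurable_restrictT _ _).1 => //; exact: measurable_funTS.
have alphaU0 z : 0 <= ((fun z => (alpha z)%:E) \_ U) z.
  by rewrite patchE; case: ifPn; rewrite ?lee_fin.
have mH : measurable_fun [set: X]
    (fun y => truncated_kernel W_ge0 M Q y (xsection U y)).
  by apply: measurable_fun_xsection_finite_kernel; rewrite inE.
have ma : measurable_fun [set: X] (fun y => (marginal_acceptance r (x, y))%:E).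
  apply/measurable_EFinP.
  apply: (measurableT_comp (acceptance_measurable (marginal_acceptance r))).
  exact: measurable_pair1.
have a0 y : 0 <= (marginal_acceptance r (x, y))%:E.
  rewrite lee_fin.
  by case/andP: (acceptance_itv (marginal_acceptance r) (x, y)).
apply: (@le_trans _ _ (accepted (weighted_proposal q Q)
    (pseudo_marginal_acceptance r Wn W_ge0) (x, w) U)); last first.
  rewrite leeDl// mule_ge0// sube_ge0 ?accepted_le1//.
  by rewrite ge0_fin_numE// (le_lt_trans (accepted_le1 _ _ _) (ltry _)).
rewrite [leRHS]integral_mkcond/= ge0_integral_joint//.
rewrite [joint _ _ _]ge0_integral_accepted//.
have mprod : measurable_fun [set: X] (fun y =>
    (marginal_acceptance r (x, y))%:E *
    truncated_kernel W_ge0 M Q y (xsection U y)).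
  exact: emeasurable_funM.
rewrite -ge0_integralZl//; last by move=> y _; rewrite mule_ge0.
apply: ge0_le_integral => //.
- by move=> y _; rewrite !mule_ge0.
- exact: measurable_funeM.
- exact: (@measurable_kfcomp _ _ _ _ _ Q).
move=> y _.
have bVa0 : 0 <= b^-1%:E * (marginal_acceptance r (x, y))%:E.
  by rewrite mule_ge0.
rewrite muleA.
have mhU : measurable_fun [set: subset_space Wn]
    ((fun u => (truncated_weight M u)%:E) \_ (xsection U y)).
  apply/(measurable_restrictT _ _).1; first exact: measurable_xsection.
  by apply/measurable_funTS/measurable_EFinP/measurable_truncated_weight.
have hU0 u : 0 <= ((fun u => (truncated_weight M u)%:E) \_ (xsection U y)) u.
  by rewrite patchE; case: ifPn; rewrite ?lee_fin.
rewrite [truncated_kernel _ _ _ _ _]integral_mkcond/= -ge0_integralZl//.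
apply: ge0_le_integral => //.
- by move=> u _; exact: mule_ge0.
- exact: emeasurable_funM (measurable_cst _) mhU.
- by apply: (measurableT_comp malphaU); exact: measurable_pair1.
move=> u _; rewrite !patchE mem_xsection.
case: ifPn => _; last by rewrite mule0.
by rewrite -!EFinM lee_fin -mulrA acceptance_factor.
Qed.

Lemma pseudo_marginal_integral_ge (R : realType) d (X : measurableType d)
    (pi : probability X R) (q : R.-pker X ~> X) (r : tierney_ratio pi q)
    (W : set R) (Wn : W !=set0) (W_ge0 : W `<=` `[0%R, +oo[)
    (Q : R.-pker X ~> subset_space Wn) (M b : R) (x : X)
    (w : subset_space Wn) (f : X * subset_space Wn -> \bar R) :
  (1 <= b)%R -> (0 < wval w)%R -> (wval w <= b)%R ->
  (forall z, 0 <= f z) -> measurable_fun [set: X * subset_space Wn] f ->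
  b^-1%:E * \int[P_acc r x]_y \int[Q y]_u ((truncated_weight M u)%:E * f (y, u))
  <= \int[pseudo_marginal r W_ge0 Q (x, w)]_z f z.
Proof.
move=> b1 w0 wb f0 mf; have b0 : (0 < b)%R := lt_le_trans w0 wb.
have bV0 : (0 <= b^-1)%R by rewrite invr_ge0 ltW.
pose mu := joint (P_acc r x) (truncated_kernel W_ge0 M Q).
have -> : \int[P_acc r x]_y \int[Q y]_u ((truncated_weight M u)%:E * f (y, u)) =
    \int[mu]_z f z.
  rewrite ge0_integral_joint//; apply: eq_integral => y _.
  rewrite [RHS]ge0_integral_accepted//.
  by apply: measurableT_comp => //; exact: measurable_pair1.
rewrite -[b^-1%R]/((NngNum bV0)%:num) -ge0_integral_mscale//.
by apply: ge0_le_measure_integral => // U mU; exact: pseudo_marginal_ge.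
Qed.

(** * Several steps *)

(** The induction peels off the first step. The factor h(u) vanishes unless
    0 < u <= M, hence the bound for the remaining steps is only needed there and
    holds with M in place of b; the new weight u then occurs in h(u) alone, and
    integrating it out yields c. *)
Lemma kernel_pow_pseudo_marginal_ge (R : realType) d (X : measurableType d)
    (pi : probability X R) (q : R.-pker X ~> X) (r : tierney_ratio pi q)
    (W : set R) (Wn : W !=set0) (W_ge0 : W `<=` `[0%R, +oo[)
    (Q : R.-pker X ~> subset_space Wn) (M c : R) :
  (1 <= M)%R -> (0 <= c)%R ->
  (forall x, c%:E <= \int[Q x]_u (truncated_weight M u)%:E) ->
  forall (A : set (X * subset_space Wn)), measurable A ->
  forall n (b : R) x w, (1 <= b)%R -> (0 < wval w)%R -> (wval w <= b)%R ->
  (b^-1 * (c / M) ^+ n)%:E *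
    \int[kernel_pow (P_acc r) n.+1 x]_y
      truncated_kernel W_ge0 M Q y (xsection A y) <=
  kernel_pow (pseudo_marginal r W_ge0 Q) n.+1 (x, w) A.
Proof.
move=> M1 c0 cQ A mA; have M0 : (0 < M)%R := lt_le_trans ltr01 M1.
pose H y := truncated_kernel W_ge0 M Q y (xsection A y).
have H0 y : 0 <= H y by [].
have mH : measurable_fun [set: X] H.
  by apply: measurable_fun_xsection_finite_kernel; rewrite inE.
have mh : measurable_fun [set: subset_space Wn]
    (fun u => (truncated_weight M u)%:E).
  exact/measurable_EFinP/measurable_truncated_weight.
have h0 u : 0 <= (@truncated_weight R W Wn M u)%:E.
  by rewrite lee_fin; case/andP: (truncated_weight_itv W_ge0 M u).
have d0 k : (0 <= (c / M) ^+ k)%R by rewrite exprn_ge0// divr_ge0// ltW.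
have dE0 k : 0 <= ((c / M) ^+ k)%:E by rewrite lee_fin.
elim=> [|n IH] b x w b1 w0 wb.
  rewrite expr0 mulr1 integral_kernel_pow1//.
  apply: (le_trans (pseudo_marginal_ge r W_ge0 Q M x b1 w0 wb mA)).
  have mA1 : measurable_fun setT (EFin \o (\1_A : X * subset_space Wn -> R)).
    by apply/measurable_EFinP; exact: measurable_indic.
  by rewrite -(setIT A) -integral_indic// -integral_kernel_pow1//
    integral_indic.
pose P z := kernel_pow (pseudo_marginal r W_ge0 Q) n.+1 z A.
have mP : measurable_fun [set: X * subset_space Wn] P.
  exact: measurable_kernel.
apply: (le_trans _ (pseudo_marginal_integral_ge r W_ge0 Q M x b1 w0 wb _ mP))
  => //.
pose I y := \int[kernel_pow (P_acc r) n.+1 y]_t H t.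
have I0 y : 0 <= I y by exact: integral_ge0.
have mI : measurable_fun [set: X] I.
  by apply: measurable_fun_integral_kernel => //; exact: measurable_kernel.
rewrite integral_kernel_powS// EFinM -muleA lee_pmul2l ?lte_fin ?invr_gt0//;
  last by rewrite (lt_le_trans _ b1).
rewrite -/H -/I -ge0_integralZl//; last by move=> y _; exact: I0.
apply: ge0_le_integral => //.
- by move=> y _; apply: mule_ge0 => //; exact: I0.
- exact: measurable_funeM.
- apply: (@measurable_kfcomp _ _ _ _ _ Q
    (fun z => (truncated_weight M z.2)%:E * P z)).
    apply: emeasurable_funM => //; apply: (measurableT_comp mh).
    exact: measurable_snd.
  by move=> z; rewrite mule_ge0.
move=> y _.
have MI0 : 0 <= (M^-1 * (c / M) ^+ n)%:E * I y.
  apply: mule_ge0; last exact: I0.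
  by rewrite lee_fin mulr_ge0// invr_ge0 ltW.
apply: (@le_trans _ _ (\int[Q y]_u
    ((M^-1 * (c / M) ^+ n)%:E * I y * (truncated_weight M u)%:E))).
  rewrite ge0_integralZl// [leRHS]muleC exprS -mulrA EFinM -[leLHS]muleA.
  exact: lee_wpmul2r.
apply: ge0_le_integral => //.
- by move=> u _; exact: mule_ge0.
- exact: measurable_funeM.
- apply: (emeasurable_funM mh).
  exact: (measurableT_comp mP (measurable_pair1 y)).
move=> u _; rewrite muleC.
have [uM|uM] := leP (wval u) M; last first.
  rewrite /truncated_weight indicE memNset ?mulr0 ?mul0e//=.
  by rewrite in_itv/= leNgt uM.
have [u0|u0] := ltP 0%R (wval u); last first.
  have -> : truncated_weight M u = 0%R; last by rewrite !mul0e.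
  apply/eqP; rewrite eq_le; case/andP: (truncated_weight_itv W_ge0 M u) => -> _.
  by rewrite andbT (le_trans (truncated_weight_le W_ge0 M u))// ge_min u0 orbT.
by rewrite lee_wpmul2l// IH.
Qed.

(** * A uniform lower bound on the truncated weights *)

(** Uniform integrability of the weights: with K a bound on the integrals of
    phi, and M such that phi(t) / t > 2 K for t > M, every weight satisfies
    w <= M h(w) + phi(w) / (2 K). Integrating bounds 1
    by 1/2 plus M times the mean of h. *)
Lemma truncated_mean_ge (R : realType) d (X : measurableType d)
    (W : set R) (Wn : W !=set0) (W_ge0 : W `<=` `[0%R, +oo[)
    (Q : R.-pker X ~> subset_space Wn)
    (Q_mean : forall x, \int[Q x]_w (wval w)%:E = 1)
    (phi : R -> R)
    (phi_ge0 : {in `[0%R, +oo[, forall t, (0 <= phi t)%R})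
    (phi_nondecreasing : {in `[0%R, +oo[ &, {homo phi : s t / (s <= t)%R}})
    (phi_liminf : limf_einf (fun t : R => (phi t / t)%:E) +oo%R = +oo)
    (phi_bounded :
      ereal_sup [set \int[Q x]_w (phi (wval w))%:E | x in [set: X]] < +oo) :
  exists M : R, (1 <= M)%R /\
    forall x, (2 * M)^-1%:E <= \int[Q x]_u (truncated_weight M u)%:E.
Proof.
pose S := ereal_sup [set \int[Q x]_w (phi (wval w))%:E | x in [set: X]].
pose K : R := fine (maxe S 1).
have KS : maxe S 1 \is a fin_num.
  rewrite ge0_fin_numE ?le_max ?lee01 ?orbT//.
  by rewrite gt_max phi_bounded ltry.
have K1 : (1 <= K)%R by rewrite -lee_fin fineK// le_max lexx orbT.
have K0 : (0 < K)%R := lt_le_trans ltr01 K1.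
have phiK x : \int[Q x]_w (phi (wval w))%:E <= K%:E.
  by rewrite fineK// le_max ereal_sup_ubound//; exists x.
have /ereal_sup_gt[_ [V [M1 [_ VM1]] <-] KV] :
    (2 * K)%:E < ereal_sup [set ereal_inf ((fun t : R => (phi t / t)%:E) @` V)
      | V in +oo%R].
  by rewrite -limf_einfE phi_liminf ltry.
pose M : R := Num.max 1%R M1.
have M_ge1 : (1 <= M)%R by rewrite le_max lexx.
have M0 : (0 < M)%R := lt_le_trans ltr01 M_ge1.
have phiM t : (M < t)%R -> (t <= (2 * K)^-1 * phi t)%R.
  move=> Mt; have t0 : (0 < t)%R := lt_trans M0 Mt.
  rewrite ler_pdivlMl ?mulr_gt0// -ler_pdivlMr//.
  rewrite -lee_fin (le_trans (ltW KV))// ereal_inf_lbound//; exists t => //.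
  by apply: VM1; rewrite (le_lt_trans _ Mt)// le_max lexx orbT.
exists M; split=> // x.
have wge0 (u : subset_space Wn) : wval u \in `[0%R, +oo[.
  by rewrite in_itv/= andbT wval_ge0.
have mphi : measurable_fun [set: subset_space Wn] (fun u => phi (wval u)).
  (* extended by phi 0 to the left of 0, phi is monotone on the whole line *)
  pose psi (t : R) : R := phi (Num.max 0%R t).
  have -> : (fun u => phi (wval u)) = psi \o @wval R W Wn.
    by apply/funext => u; rewrite /psi/= max_r// wval_ge0.
  apply: measurableT_comp; last exact: measurable_wval.
  apply: nondecreasing_measurable => // s t st.
  have max0 (a : R) : Num.max 0%R a \in `[0%R, +oo[.
    by rewrite in_itv/= andbT le_max lexx.
  apply: phi_nondecreasing => //.
  by rewrite ge_max !le_max lexx st orbT.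
have mh : measurable_fun [set: subset_space Wn]
    (fun u => (truncated_weight M u)%:E).
  exact/measurable_EFinP/measurable_truncated_weight.
have h0 u : 0 <= (@truncated_weight R W Wn M u)%:E.
  by rewrite lee_fin; case/andP: (truncated_weight_itv W_ge0 M u).
have p0 (u : subset_space Wn) : 0 <= (phi (wval u))%:E.
  by rewrite lee_fin phi_ge0.
have KV0 : 0 <= (2 * K)^-1%:E by rewrite lee_fin invr_ge0 mulr_ge0// ltW.
have pointwise (u : subset_space Wn) :
    (wval u)%:E <= M%:E * (truncated_weight M u)%:E +
                   (2 * K)^-1%:E * (phi (wval u))%:E.
  have [uM|Mu] := leP (wval u) M; last first.
    rewrite (@le_trans _ _ ((2 * K)^-1%:E * (phi (wval u))%:E))//.
      by rewrite -EFinM lee_fin phiM.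
    by rewrite leeDr// mule_ge0// lee_fin ltW.
  rewrite (@le_trans _ _ (M%:E * (truncated_weight M u)%:E)) ?leeDl ?mule_ge0//.
  rewrite -EFinM lee_fin /truncated_weight indicE mem_set/= ?in_itv//= mulr1.
  have u0 := wval_ge0 W_ge0 u.
  by have [u1|u1] := leP 1%R (wval u); rewrite ?mulr1// ler_peMl.
have : 1 <= M%:E * \int[Q x]_u (truncated_weight M u)%:E + (2^-1)%:E.
  rewrite -(Q_mean x).
  apply: (@le_trans _ _ (\int[Q x]_u (M%:E * (truncated_weight M u)%:E +
                   (2 * K)^-1%:E * (phi (wval u))%:E))).
    apply: ge0_le_integral => //.
    - by move=> u _; rewrite lee_fin wval_ge0.
    - exact/measurable_EFinP/measurable_wval.
    - apply: emeasurable_funD; apply: measurable_funeM => //.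
      exact/measurable_EFinP.
  rewrite ge0_integralD//; last 4 first.
  - by move=> u _; rewrite mule_ge0// lee_fin ltW.
  - exact: measurable_funeM.
  - by move=> u _; rewrite mule_ge0.
  - by apply: measurable_funeM; exact/measurable_EFinP.
  rewrite !ge0_integralZl ?lee_fin ?(ltW M0)//; last exact/measurable_EFinP.
  rewrite leeD2l// (le_trans (lee_wpmul2l KV0 (phiK x)))//.
  by rewrite -EFinM lee_fin invfM -mulrA mulVf ?mulr1// gt_eqF.
have : \int[Q x]_u (truncated_weight M u)%:E \is a fin_num.
  rewrite ge0_fin_numE ?integral_ge0// (@le_lt_trans _ _ (\int[Q x]_u 1))//.
    apply: ge0_le_integral => // u _; rewrite lee_fin.
    by case/andP: (truncated_weight_itv W_ge0 M u).
  by rewrite integral_cst// mul1e prob_kernel ltry.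
move/fineK => <-; rewrite -EFinM -EFinD !lee_fin => hM.
rewrite invfM mulrC ler_pdivrMl//.
apply: (@le_trans _ _ (1 - 2^-1)%R); last by rewrite lerBlDr.
by rewrite [X in (X - _)%R](splitr 1%R) mul1r addrK.
Qed.

(** * The minorization *)

Theorem lemma32 (R : realType) (d : measure_display) (X : measurableType d)
    (pi : probability X R) (q : R.-pker X ~> X) (r : tierney_ratio pi q)
    (W : set R) (Wn : W !=set0) (W_ge0 : W `<=` `[0%R, +oo[)
    (W_borel : measurable W)
    (Q : R.-pker X ~> subset_space Wn)
    (Q_mean : forall x, \int[Q x]_w (wval w)%:E = 1)
    (phi : R -> R)
    (phi_ge1 : {in `[0%R, +oo[, forall t, (1 <= phi t)%R})
    (phi_nondecreasing : {in `[0%R, +oo[ &, {homo phi : s t / (s <= t)%R}})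
    (phi_convex : convex_function (`[0%R, +oo[ : set R) phi)
    (phi_liminf : limf_einf (fun t : R => (phi t / t)%:E) +oo%R = +oo)
    (phi_bounded :
      ereal_sup [set \int[Q x]_w (phi (wval w))%:E | x in [set: X]] < +oo)
    (eps : R) (n : nat) (nu : probability X R)
    (eps_gt0 : (0 < eps)%R) (n_gt0 : (0 < n)%N)
    (minorization : forall A : set X, measurable A ->
      forall x, eps%:E * nu A <= kernel_pow (P_acc r) n x A) :
  exists (wbar0 eps' : R) (nu' : probability (X * subset_space Wn)%type R),
    [/\ (1 < wbar0)%R, (0 < eps')%R &
      forall wbar : R, (wbar0 <= wbar)%R ->
      forall (x : X) (w : subset_space Wn), (0 < wval w)%R ->
        (wval w <= wbar)%R ->
      forall A : set (X * subset_space Wn), measurable A ->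
        (eps' / wbar)%:E * nu' A
          <= kernel_pow (pseudo_marginal r W_ge0 Q) n (x, w) A].
Proof.
have [M [M1 hM]] := truncated_mean_ge W_ge0 Q_mean
  (fun t t0 => le_trans ler01 (phi_ge1 t t0)) phi_nondecreasing phi_liminf
  phi_bounded.
have M0 : (0 < M)%R := lt_le_trans ltr01 M1.
pose c : R := (2 * M)^-1%R.
have c0 : (0 < c)%R by rewrite invr_gt0 mulr_gt0.
pose mu : {measure set (X * subset_space Wn) -> \bar R} :=
  joint nu (truncated_kernel W_ge0 M Q).
have /andP[cmu mu1] : c%:E <= mu setT <= 1.
  by apply: joint_setT_itv (ltW c0) _ => x; exact: hM.
have muT : 0 < mu setT < +oo.
  by rewrite (lt_le_trans _ cmu) ?lte_fin// (le_lt_trans mu1) ?ltry.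
have mu0 : (0 < fine (mu setT))%R by exact: fine_gt0.
pose eps' : R := ((c / M) ^+ n.-1 * eps * fine (mu setT))%R.
(* 2 stands for any number above 1 *)
exists 2%R, eps', (mnormalize mu (\d_point)); split.
- by rewrite ltr1n.
- by rewrite !mulr_gt0// exprn_gt0// divr_gt0.
move=> b b2 x w w0 wb A mA.
have b1 : (1 <= b)%R by rewrite (le_trans _ b2)// ler1n.
have b0 : (0 < b)%R := lt_le_trans ltr01 b1.
have := kernel_pow_pseudo_marginal_ge r W_ge0 M1 (ltW c0) hM mA n.-1 x b1 w0 wb.
rewrite (prednK n_gt0); apply: le_trans.
have -> : (eps' / b)%:E * mnormalize mu (\d_point) A =
    (b^-1 * (c / M) ^+ n.-1)%:E * (eps%:E * mu A).
  rewrite (mnormalizeE (\d_point) A muT) !muleA -!EFinM; congr (_%:E * _).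
  by rewrite /eps' mulrC !mulrA.
rewrite lee_wpmul2l//.
  by rewrite lee_fin mulr_ge0 ?invr_ge0 ?exprn_ge0 ?divr_ge0 ?ltW.
rewrite -[eps]/((NngNum (ltW eps_gt0))%:num).
rewrite /mu /joint -ge0_integral_mscale//.
  apply: ge0_le_measure_integral => //.
    by move=> B mB; exact: minorization.
all: by apply: measurable_fun_xsection_finite_kernel; rewrite inE.
Qed.
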